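(* $f(n)=\Omega(n^{-6/7})$ as $n\to\infty$. That is, there exist a constant $c'>0$ and an integer $n_0$ such that for every $n\ge n_0$ and every set of $n$ points in the plane $\mathbb{R}^2$ with minimum distance at least one, the distances $d_1\le d_2\le\dots\le d_{\binom n2}$ determined by the points satisfy $$\sum_{1\le i<\binom n2}(d_{i+1}-d_i)^2\ge c'\,n^{-6/7}.$$
   Context: Distances are Euclidean. For a set of $n$ points in the plane, $d_1\le d_2\le\dots\le d_{\binom n2}$ is the list, in non-decreasing order and with multiplicity, of the distances between its $\binom n2$ pairs of distinct points. ''Minimum distance at least one'' means $d_1\ge 1$. The function $f(n)$ is the minimum of $\sum_{1\le i<\binom n2}(d_{i+1}-d_i)^2$ over all $n$-element point sets in the plane with $d_1\ge 1$. *)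

(* Defs.v *)
From HB Require Import structures.
From mathcomp Require Import all_boot all_order all_algebra finmap.
From mathcomp Require Import all_classical all_reals all_analysis.

Set Implicit Arguments.
Unset Strict Implicit.
Unset Printing Implicit Defensive.

Import Order.TTheory GRing.Theory Num.Theory.
Local Open Scope ring_scope.

(* The library's distance on the product R * R comes from the sup norm, hence
   an explicit Euclidean distance. *)
Definition edist (R : realType) (p q : R * R) : R :=
  Num.sqrt ((p.1 - q.1) ^+ 2 + (p.2 - q.2) ^+ 2).

(* One entry for each pair of positions i < j in s. *)
Fixpoint pair_dists (R : realType) (s : seq (R * R)) : seq R :=
  if s is p :: s' then [seq edist p q | q <- s'] ++ pair_dists s' else [::].

(* The result does not depend on the order in which P is enumerated, since
   edist is symmetric and the list is sorted. *)
Definition sorted_dists (R : realType) (P : {fset R * R}) : seq R :=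
  sort <=%R (pair_dists (enum_fset P)).

(* The i-th smallest distance, with i counted from 1; only meaningful for
   1 <= i <= 'C(#|` P|, 2), and 0 for larger i. *)
Definition nth_dist (R : realType) (P : {fset R * R}) (i : nat) : R :=
  (sorted_dists P)`_i.-1.

Lemma size_pair_dists (R : realType) (s : seq (R * R)) :
  size (pair_dists s) = 'C(size s, 2).
Proof.
elim: s => [|p s IHs] //=.
by rewrite size_cat size_map IHs binS bin1 addnC.
Qed.

Lemma size_sorted_dists (R : realType) (P : {fset R * R}) :
  size (sorted_dists P) = 'C(#|` P|, 2).
Proof. by rewrite size_sort size_pair_dists. Qed.

(* Main.v *)
Require Import Defs.
From HB Require Import structures.
From mathcomp Require Import all_boot all_order all_algebra finmap.
From mathcomp Require Import all_classical all_reals all_analysis.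
From mathcomp Require Import ring lra.

(** Let [D] be the diameter of a 1-separated set of [n] points, let [S] be the
    sum of the squared gaps, and put [y = n ^ (2/7)], so that [y ^ 7 = n ^ 2].
    For any [j], the Cauchy-Schwarz inequality applied to the gaps between
    the [j]-th and the largest distance gives
    [(d_N - d_j) ^ 2 <= (N - j) * S] ([sqr_gap_le]).

    If [D >= y ^ 2], use all the gaps: [D - d_1] is of order [D] and there are
    at most [n ^ 2] gaps, so [S] is at least of order
    [y ^ 4 / y ^ 7 = y ^ (-3) = n ^ (-6/7)] ([gaps_long_diameter]).

    If [D <= y ^ 2], use only the gaps that meet [[D - 1, D]]: they cover a length
    of at least 1, so [S] is at least the inverse of the number of pairs at
    distance at least [D - 1].  The heart of the proof is that there are only
    [O(D ^ (3/2))] such pairs ([near_diameter_count]), and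
    [D ^ (3/2) <= y ^ 3] ([gaps_short_diameter]).

    For this count, split the directions into [O(sqrt D)] classes such that the
    vectors of two long pairs [pq], [p0q0] in one class differ by [O(sqrt D)]
    ([edge_class_close]).
    In the frame of [p0q0] both pairs have length at least [D - O(1)] along the
    axis, whereas no distance exceeds [D]; comparing with the cross distances
    [pq0] and [p0q] shows that [p] is within [O(1)] of [p0] along the axis, and
    within [O(sqrt D)] across it ([endpoint_strip]).  The same holds for [q]
    and [q0].  Such a strip contains [O(sqrt D)] points, hence a class contains
    [O(D)] pairs ([edges_of_class]).

    Both cases need [D] to be large compared with [d_1]; this holds for large
    [n] because only [O((D / d_1) ^ 2)] points fit in a set of diameter [D]
    ([packing]). *)

Import Order.TTheory GRing.Theory Num.Theory.
Local Open Scope ring_scope.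

Set Implicit Arguments.
Unset Strict Implicit.
Unset Printing Implicit Defensive.

(** Disambiguates from the extended-real distance of the same name. *)
Local Notation euclid := Defs.edist.

(** * Finite counting and the Cauchy-Schwarz inequality *)

Lemma size_le_fibers (T U : eqType) (f : T -> U) (ks : seq U) (E : seq T) (m : nat) :
  {in E, forall x, f x \in ks} ->
  (forall k, (count (fun x => f x == k) E <= m)%N) ->
  (size E <= size ks * m)%N.
Proof.
move=> fE fib; elim: ks E fE fib => [|k ks IH] E fE fib.
  by case: E fE {fib} => // x E /(_ x); rewrite inE eqxx => /(_ isT).
rewrite -(count_predC (fun x => f x == k)) mulSn leq_add ?fib //.
rewrite -size_filter; apply: IH => [x|l].
  by rewrite mem_filter /= => /andP[fxk /fE]; rewrite inE (negbTE fxk).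
rewrite count_filter; apply: leq_trans (fib l).
by apply: sub_count => x /= /andP[].
Qed.

Lemma size_le_inj (T U : eqType) (f : T -> U) (ks : seq U) (E : seq T) :
  uniq E -> {in E, forall x, f x \in ks} -> {in E &, injective f} ->
  (size E <= size ks)%N.
Proof.
move=> uE fE finj; rewrite -(size_map f); apply: uniq_leq_size.
  by rewrite map_inj_in_uniq.
by move=> _ /mapP[x xE ->]; exact: fE.
Qed.

(** Expand the sum of [(g i - S / k) ^+ 2 >= 0], where [S / k] is the mean of
    the [k] values. *)
Lemma sqr_sum_le (R : realFieldType) (g : nat -> R) (m n : nat) :
  (\sum_(m <= i < n) g i) ^+ 2 <= (n - m)%:R * \sum_(m <= i < n) g i ^+ 2.
Proof.
have [le_nm|lt_mn] := leqP n m.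
  by rewrite !big_geq // expr0n mulr0.
set S := \sum_(m <= i < n) g i; set k : R := (n - m)%:R.
have k0 : 0 < k by rewrite ltr0n subn_gt0.
have : 0 <= \sum_(m <= i < n) (g i - S / k) ^+ 2.
  by apply: sumr_ge0 => i _; exact: sqr_ge0.
have -> : \sum_(m <= i < n) (g i - S / k) ^+ 2 =
    \sum_(m <= i < n) g i ^+ 2 - S ^+ 2 / k.
  under eq_bigr => i _ do rewrite sqrrB -mulrnAr.
  rewrite big_split /= sumrB -mulr_suml -/S sumr_const_nat -mulr_natl -/k.
  by field; rewrite gt_eqF.
by rewrite subr_ge0 ler_pdivrMr // mulrC.
Qed.

(** * Pairs of points and the Euclidean distance *)

Section Geometry.
Variable R : realType.
Implicit Types (p q u v w : R * R) (s : seq (R * R)).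

(** The pairs of points behind the entries of [pair_dists], in the same order. *)
Fixpoint pairs s : seq ((R * R) * (R * R)) :=
  if s is p :: s' then [seq (p, q) | q <- s'] ++ pairs s' else [::].

Lemma pair_distsE s : pair_dists s = [seq euclid e.1 e.2 | e <- pairs s].
Proof. by elim: s => //= p s ->; rewrite map_cat -map_comp. Qed.

Lemma mem_pairs s e : e \in pairs s -> (e.1 \in s) /\ (e.2 \in s).
Proof.
elim: s => //= p s IH; rewrite mem_cat => /orP[/mapP[q qs ->]|/IH[e1 e2]] /=.
  by rewrite !inE eqxx qs orbT.
by rewrite !inE e1 e2 !orbT.
Qed.

Lemma uniq_pairs s : uniq s -> uniq (pairs s).
Proof.
elim: s => //= p s IH /andP[ps us]; rewrite cat_uniq IH // andbT.
rewrite map_inj_uniq ?us /=; last by move=> ? ? [].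
apply/hasPn => e /mem_pairs[e1 _]; apply/mapP => -[q _ ee].
by rewrite ee /= (negbTE ps) in e1.
Qed.

Lemma euclidC p q : euclid p q = euclid q p.
Proof. by rewrite /Defs.edist -sqrrN opprB -[X in _ + X]sqrrN opprB. Qed.

Lemma euclid_in_pair_dists s p q : p \in s -> q \in s -> p != q ->
  euclid p q \in pair_dists s.
Proof.
elim: s => //= r s IH; rewrite !inE mem_cat => /orP[/eqP->|ps] /orP[/eqP->|qs] pq.
- by rewrite eqxx in pq.
- by rewrite map_f.
- by rewrite euclidC map_f.
- by rewrite IH // orbT.
Qed.

Definition dot v w : R := v.1 * w.1 + v.2 * w.2.
Definition cross v w : R := v.1 * w.2 - v.2 * w.1.

Lemma euclid_sqr p q : euclid p q ^+ 2 = dot (p - q) (p - q).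
Proof. by rewrite sqr_sqrtr ?addr_ge0 ?sqr_ge0 // /dot /= !expr2. Qed.

Lemma euclid_ge0 p q : 0 <= euclid p q.
Proof. exact: sqrtr_ge0. Qed.

(** Pythagoras in the orthonormal frame whose first axis is [u]. *)
Lemma dot_cross u w : dot u u = 1 -> dot w w = dot u w ^+ 2 + cross u w ^+ 2.
Proof.
move=> u1; transitivity (dot u u * dot w w); first by rewrite u1 mul1r.
by rewrite /dot /cross; ring.
Qed.

(** * Cells and packing *)

(** The index of the interval of length [w] that contains [x], in the
    subdivision of the half-line that starts at [a]. *)
Definition cell (a w x : R) : nat := Num.truncn ((x - a) / w).

Lemma cell_bound (a b w x : R) : 0 < w -> a <= x <= b ->
  (cell a w x < (Num.truncn ((b - a) / w)).+1)%N.
Proof.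
move=> w0 /andP[ax xb]; rewrite ltnS; apply: le_truncn.
by rewrite ler_pM2r ?invr_gt0 // lerD2r.
Qed.

Lemma cell_close (a w x y : R) :
  0 < w -> a <= x -> a <= y -> cell a w x = cell a w y -> `|x - y| < w.
Proof.
move=> w0 ax ay xy.
have := truncn_itv (divr_ge0 (etrans (subr_ge0 a x) ax) (ltW w0)).
have := truncn_itv (divr_ge0 (etrans (subr_ge0 a y) ay) (ltW w0)).
rewrite -/(cell a w x) -/(cell a w y) xy -natr1.
rewrite !ler_pdivlMr // !ltr_pdivrMr // => /andP[y1 y2] /andP[x1 x2].
by rewrite ltr_norml; apply/andP; split; lra.
Qed.

(** Two points in a square of side [d / 2] are at distance less than [d]. *)
Lemma same_cells_close u p q (x0 y0 d : R) :
  dot u u = 1 -> 0 < d ->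
  x0 <= dot u p -> x0 <= dot u q -> y0 <= cross u p -> y0 <= cross u q ->
  cell x0 (d / 2) (dot u p) = cell x0 (d / 2) (dot u q) ->
  cell y0 (d / 2) (cross u p) = cell y0 (d / 2) (cross u q) ->
  euclid p q < d.
Proof.
move=> u1 d0 xp xq yp yq /cell_close cx /cell_close cy.
have d20 : 0 < d / 2 by rewrite divr_gt0.
have {}cx := cx d20 xp xq; have {}cy := cy d20 yp yq.
rewrite -(@ltr_pXn2r _ 2) ?nnegrE ?euclid_ge0 ?(ltW d0) //.
rewrite euclid_sqr (dot_cross _ u1).
have -> : dot u (p - q) = dot u p - dot u q by rewrite /dot /=; ring.
have -> : cross u (p - q) = cross u p - cross u q by rewrite /cross /=; ring.
have sq (x : R) : `|x| < d / 2 -> x ^+ 2 < (d / 2) ^+ 2.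
  by move=> xd; rewrite -real_normK ?num_real // ltr_pXn2r ?nnegrE ?(ltW d20).
have := sq _ cx; have := sq _ cy; nra.
Qed.

(** All the points lie in the square of side [2 * D] centred at one of them;
    squares of side [d / 2] contain at most one point each. *)
Lemma packing s (d D : R) (k : nat) :
  uniq s -> 0 < d -> 4 * D <= k%:R * d ->
  {in s &, forall p q, p != q -> d <= euclid p q} ->
  {in s &, forall p q, p != q -> euclid p q <= D} ->
  (size s <= k.+1 * k.+1)%N.
Proof.
move=> us d0 Dk sep diam.
case: s us sep diam => [//|r [//|q s]]; set s' := [:: r, q & s] => us sep diam.
have rs : r \in s' by rewrite mem_head.
have d20 : 0 < d / 2 by rewrite divr_gt0.
have D0 : 0 <= D.
  have rq : r != q by move: us; rewrite /s' /= inE negb_or => /andP[/andP[]].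
  apply: le_trans (diam r q rs _ rq); rewrite ?euclid_ge0 //.
  by rewrite !inE eqxx orbT.
pose u : R * R := (1, 0).
have u1 : dot u u = 1 by rewrite /dot /=; ring.
have up p : dot u p = p.1 by rewrite /dot /=; ring.
have uc p : cross u p = p.2 by rewrite /cross /=; ring.
have box p : p \in s' -> (r.1 - D <= p.1 <= r.1 + D) /\ (r.2 - D <= p.2 <= r.2 + D).
  move=> ps; have : (p.1 - r.1) ^+ 2 + (p.2 - r.2) ^+ 2 <= D ^+ 2.
    have [->|pr] := eqVneq p r; first by rewrite !subrr expr0n addr0 sqr_ge0.
    have := diam p r ps rs pr; rewrite -(@ler_pXn2r _ 2) ?nnegrE ?euclid_ge0 //.
    by rewrite euclid_sqr /dot /= !expr2.
  move=> h; have h1 : (p.1 - r.1) ^+ 2 <= D ^+ 2.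
    by apply: le_trans h; rewrite lerDl sqr_ge0.
  have h2 : (p.2 - r.2) ^+ 2 <= D ^+ 2.
    by apply: le_trans h; rewrite lerDr sqr_ge0.
  by split; apply/andP; split; nra.
pose f p := (cell (r.1 - D) (d / 2) p.1, cell (r.2 - D) (d / 2) p.2).
pose ks := [seq (i, j) | i <- iota 0 k.+1, j <- iota 0 k.+1].
have -> : (k.+1 * k.+1 = size ks)%N by rewrite size_allpairs size_iota.
have cb c x : c - D <= x <= c + D -> (cell (c - D) (d / 2) x < k.+1)%N.
  move=> /(cell_bound d20) h; apply: leq_trans h _; rewrite ltnS.
  rewrite -[leqRHS](@natrK R); apply: le_truncn.
  by rewrite ler_pdivrMr //; lra.
apply: (@size_le_inj _ _ f) => //.
  by move=> p /box[p1 p2]; apply: allpairs_f; rewrite mem_iota cb.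
move=> p p' ps ps' [c1 c2]; apply/eqP/negPn/negP => pp'.
have := sep p p' ps ps' pp'; apply/negP; rewrite -ltNge.
have [/andP[p1 _] /andP[p2 _]] := box p ps.
have [/andP[q1 _] /andP[q2 _]] := box p' ps'.
by apply: (@same_cells_close u _ _ (r.1 - D) (r.2 - D)) => //; rewrite ?up ?uc.
Qed.

(** * Directions of long edges *)

(** The two squared norms differ by at most [2 * D], and the squared minor
    coordinates by at most [2 * D * h]; as [a + a0 >= D], the major coordinates
    differ by at most [2 * (1 + h) <= 4 * h]. *)
Lemma near_vectors (D h a b a0 b0 : R) :
  h ^+ 2 = D -> 64 <= D -> 1 <= h ->
  `|b| <= a -> `|b0| <= a0 -> `|b - b0| <= h ->
  (D - 1) ^+ 2 <= a ^+ 2 + b ^+ 2 <= D ^+ 2 ->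
  (D - 1) ^+ 2 <= a0 ^+ 2 + b0 ^+ 2 <= D ^+ 2 ->
  (a - a0) ^+ 2 + (b - b0) ^+ 2 <= 17 * D.
Proof.
move=> hD D64 h1 ba ba0 bb /andP[l r] /andP[l0 r0].
(* The major coordinate carries at least half of the squared norm. *)
have half (x y : R) : `|y| <= x -> (D - 1) ^+ 2 <= x ^+ 2 + y ^+ 2 -> D / 2 <= x.
  by rewrite ler_norml => /andP[y1 y2] xy; rewrite leNgt; apply/negP => xD; nra.
have aD := half _ _ ba l; have a0D := half _ _ ba0 l0.
have up (x y : R) : 0 <= x -> `|y| <= x -> x ^+ 2 + y ^+ 2 <= D ^+ 2 -> `|y| <= D.
  rewrite !ler_norml => x0 /andP[y1 y2] xy; apply/andP; split; nra.
have bD := up _ _ (le_trans (normr_ge0 _) ba) ba r.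
have b0D := up _ _ (le_trans (normr_ge0 _) ba0) ba0 r0.
have key : `|a - a0| * (a + a0) <= 2 * D * (1 + h).
  have -> : `|a - a0| * (a + a0) = `|(a - a0) * (a + a0)|.
    by rewrite normrM (ger0_norm (_ : 0 <= a + a0)) //; lra.
  have -> : (a - a0) * (a + a0) =
    ((a ^+ 2 + b ^+ 2) - (a0 ^+ 2 + b0 ^+ 2)) - (b - b0) * (b + b0) by ring.
  apply: le_trans (ler_normB _ _) _.
  have -> : 2 * D * (1 + h) = 2 * D + h * (2 * D) by ring.
  apply: lerD; first by rewrite ler_norml; apply/andP; split; nra.
  rewrite normrM; apply: ler_pM => //.
  by apply: le_trans (ler_normD _ _) _; lra.
have aa : `|a - a0| <= 4 * h.
  have : `|a - a0| * D <= (2 * (1 + h)) * D.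
    rewrite [leRHS]mulrAC; apply: le_trans key; apply: ler_wpM2l => //; lra.
  by rewrite ler_pM2r; lra.
have sq (x y : R) : `|x| <= y -> x ^+ 2 <= y ^+ 2.
  by rewrite ler_norml => /andP[? ?]; nra.
have := sq _ _ aa; have := sq _ _ bb; rewrite exprMn hD; lra.
Qed.

(** Replaces the angle of [v], in steps of [h / D]: the major axis, the sign of
    the major coordinate, and the cell of the minor coordinate. *)
Definition edge_class (D h : R) v : bool * bool * nat :=
  if `|v.2| <= `|v.1| then (true, 0 <= v.1, cell (- D) h v.2)
  else (false, 0 <= v.2, cell (- D) h v.1).

Lemma edge_class_close (D h : R) v w :
  h ^+ 2 = D -> 64 <= D -> 1 <= h ->
  (D - 1) ^+ 2 <= dot v v <= D ^+ 2 -> (D - 1) ^+ 2 <= dot w w <= D ^+ 2 ->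
  edge_class D h v = edge_class D h w ->
  dot (v - w) (v - w) <= 17 * D.
Proof.
move=> hD D64 h1.
have h0 : 0 < h by lra.
have signed (a b a0 b0 : R) :
    (D - 1) ^+ 2 <= a ^+ 2 + b ^+ 2 <= D ^+ 2 ->
    (D - 1) ^+ 2 <= a0 ^+ 2 + b0 ^+ 2 <= D ^+ 2 ->
    `|b| <= `|a| -> `|b0| <= `|a0| -> (0 <= a) = (0 <= a0) ->
    cell (- D) h b = cell (- D) h b0 ->
    (a - a0) ^+ 2 + (b - b0) ^+ 2 <= 17 * D.
  move=> n n0 ba ba0 sg cb.
  have lb (x y : R) : x ^+ 2 + y ^+ 2 <= D ^+ 2 -> - D <= y.
    by move=> xy; rewrite leNgt; apply/negP => yD; nra.
  have bb : `|b - b0| <= h.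
    case/andP: n => _ /lb n; case/andP: n0 => _ /lb n0.
    by apply/ltW/(@cell_close (- D)).
  case: (leP 0 a) sg => a_0 /esym sg.
    rewrite (ger0_norm a_0) in ba; rewrite (ger0_norm sg) in ba0.
    exact: (near_vectors hD D64 h1).
  have {}sg : a0 < 0 by rewrite ltNge sg.
  rewrite (ltr0_norm a_0) in ba; rewrite (ltr0_norm sg) in ba0.
  rewrite -[a - a0]opprK sqrrN opprB -[a0 - a]/(a0 - a).
  have -> : a0 - a = - a - - a0 by ring.
  by apply: (near_vectors hD D64 h1) => //; rewrite sqrrN.
rewrite /edge_class /dot -!expr2 /=.
case: ifP => v12; case: ifP => w12 nv nw //.
  by case=> sg cl; apply: signed.
move/negbT: v12; move/negbT: w12; rewrite -!ltNge => /ltW w12 /ltW v12 [sg cl].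
rewrite [v.1 ^+ 2 + _]addrC in nv; rewrite [w.1 ^+ 2 + _]addrC in nw.
by rewrite addrC; apply: signed.
Qed.

(** Along [u], the vector [q - p] has length at least [D - 11], since it is close
    to [q0 - p0 = L * u] and about as long.  As [q0 - p] and [q - p0] have
    length at most [D], the point [p] can be neither far behind [p0] nor far
    ahead of it.  Then [q0 - p] has length at least [D - 12] along [u], which
    leaves at most [D ^+ 2 - (D - 12) ^+ 2 <= 25 * D] for the square of its
    component across [u]. *)
Lemma endpoint_strip (D : R) p q p0 q0 u (L : R) :
  64 <= D -> D - 1 <= L <= D -> dot u u = 1 -> q0 - p0 = (L * u.1, L * u.2) ->
  (D - 1) ^+ 2 <= dot (q - p) (q - p) ->
  dot ((q - p) - (q0 - p0)) ((q - p) - (q0 - p0)) <= 17 * D ->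
  dot (q0 - p) (q0 - p) <= D ^+ 2 -> dot (q - p0) (q - p0) <= D ^+ 2 ->
  - 1 <= dot u (p - p0) <= 11 /\ cross u (p - p0) ^+ 2 <= 25 * D.
Proof.
move=> D64 /andP[L1 L2] u1 v0E vD close pq0 qp0.
have L0 : 0 < L by lra.
have v0L : dot u (q0 - p0) = L.
  by rewrite v0E /dot /= mulrCA [u.2 * _]mulrCA -mulrDr -/(dot u u) u1 mulr1.
have v00 : dot (q0 - p0) (q0 - p0) = L ^+ 2.
  transitivity (L ^+ 2 * dot u u); last by rewrite u1 mulr1.
  by rewrite v0E /dot /=; ring.
have along w : dot w w <= D ^+ 2 -> dot u w <= D.
  rewrite (dot_cross w u1) => wD; rewrite leNgt; apply/negP => lt.
  have := sqr_ge0 (cross u w); nra.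
(* The polarization identity turns closeness into a bound on the component
   of q - p along u. *)
have polar : dot ((q - p) - (q0 - p0)) ((q - p) - (q0 - p0)) =
    dot (q - p) (q - p) + dot (q0 - p0) (q0 - p0) - 2 * L * dot u (q - p).
  have -> : 2 * L * dot u (q - p) = 2 * dot (L * u.1, L * u.2) (q - p).
    by rewrite /dot /=; ring.
  by rewrite -v0E /dot /=; ring.
have vu : D - 11 <= dot u (q - p).
  rewrite leNgt; apply/negP => lt.
  have : L * dot u (q - p) <= L * (D - 11) by rewrite ler_pM2l // ltW.
  have := sqr_ge0 (D - L); nra.
have e1 : dot u (p - p0) = L - dot u (q0 - p) by rewrite -v0L /dot /=; ring.
have e2 : dot u (p - p0) = dot u (q - p0) - dot u (q - p) by rewrite /dot /=; ring.
have e3 : cross u (p - p0) = - cross u (q0 - p).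
  have -> : cross u (p - p0) = cross u (q0 - p0) - cross u (q0 - p).
    by rewrite /cross /=; ring.
  by rewrite v0E {1}/cross /=; ring.
have b1 : dot u (p - p0) <= 11 by have := along _ qp0; lra.
have b0 : -1 <= dot u (p - p0) by have := along _ pq0; lra.
split; first by rewrite b0.
rewrite e3 sqrrN; have := dot_cross (q0 - p) u1.
have : D - 12 <= dot u (q0 - p) by lra.
nra.
Qed.

Lemma euclid_translate c p q : euclid (p - c) (q - c) = euclid p q.
Proof. by rewrite /Defs.edist /=; congr Num.sqrt; ring. Qed.

Lemma sqr_le_itv (x y : R) : 0 <= y -> x ^+ 2 <= y ^+ 2 -> - y <= x <= y.
Proof. by move=> y0 xy; apply/andP; split; nra. Qed.

Lemma dotN v : dot (- v) (- v) = dot v v.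
Proof. by rewrite /dot /=; ring. Qed.

(** * Counting the pairs of nearly maximal distance *)

Section NearDiameter.
Variables (s : seq (R * R)) (D h : R).
Hypotheses (us : uniq s) (hD : h ^+ 2 = D) (D64 : 64 <= D) (h1 : 1 <= h).
Hypothesis sep : {in s &, forall p q, p != q -> 1 <= euclid p q}.
Hypothesis diam : {in s &, forall p q, p != q -> euclid p q <= D}.

Let D0 : 0 <= D. Proof. by apply: le_trans D64; lra. Qed.
Let D10 : 0 <= D - 1. Proof. by have := D64; lra. Qed.
Let h0 : 0 < h. Proof. by have := h1; lra. Qed.
Let h50 : 0 <= 5 * h. Proof. by have := h1; lra. Qed.

Lemma dot_diam p q : p \in s -> q \in s -> dot (q - p) (q - p) <= D ^+ 2.
Proof.
move=> ps qs; have [->|qp] := eqVneq q p.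
  by rewrite subrr /dot /= !mulr0 addr0 sqr_ge0.
by rewrite -euclid_sqr ler_pXn2r ?nnegrE ?euclid_ge0 ?diam.
Qed.

Lemma dot_long p q : D - 1 <= euclid p q -> (D - 1) ^+ 2 <= dot (q - p) (q - p).
Proof.
by move=> l; rewrite -(opprB p q) dotN -euclid_sqr ler_pXn2r ?nnegrE ?euclid_ge0.
Qed.

Definition strip_cells := iota 0 (Num.truncn (12 / (1 / 2) : R)).+1.
Definition height_cells := iota 0 (Num.truncn (10 * h / (1 / 2))).+1.

Definition strip_cell c u p : nat * nat :=
  (cell (- 1) (1 / 2) (dot u (p - c)), cell (- (5 * h)) (1 / 2) (cross u (p - c))).

(** The strip given by [endpoint_strip], where [25 * D = (5 * h) ^+ 2]. *)
Definition in_strip c u p :=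
  - 1 <= dot u (p - c) <= 11 /\ - (5 * h) <= cross u (p - c) <= 5 * h.

Definition strip_grid := [seq (i, j) | i <- strip_cells, j <- height_cells].

Lemma strip_cell_grid c u p : in_strip c u p -> strip_cell c u p \in strip_grid.
Proof.
have w0 : 0 < 1 / 2 :> R by rewrite divr_gt0.
move=> [/(cell_bound w0) x /(cell_bound w0) y].
rewrite /strip_cell; apply: allpairs_f; rewrite mem_iota /= add0n.
  by apply: leq_trans x _; rewrite ltnS; apply: le_truncn; lra.
by apply: leq_trans y _; rewrite ltnS; apply: le_truncn; lra.
Qed.

Lemma strip_cell_inj c u p q : dot u u = 1 -> p \in s -> q \in s ->
  in_strip c u p -> in_strip c u q -> strip_cell c u p = strip_cell c u q -> p = q.
Proof.
move=> u1 ps qs [/andP[px _] /andP[py _]] [/andP[qx _] /andP[qy _]] [cx cy].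
apply/eqP/negPn/negP => /(sep ps qs); apply/negP; rewrite -ltNge.
rewrite -(euclid_translate c).
by apply: (same_cells_close u1 ltr01 px qx py qy).
Qed.

(** Fix one edge [p0q0] of the class.  An edge [pq] is determined by the cell of
    [p] in the strip at [p0] with axis [q0 - p0] and by the cell of [q] in the
    strip at [q0] with the opposite axis. *)
Lemma edges_of_class (F : seq ((R * R) * (R * R))) k :
  uniq F ->
  {in F, forall e, [/\ e.1 \in s, e.2 \in s, D - 1 <= euclid e.1 e.2
                     & edge_class D h (e.2 - e.1) = k]} ->
  (size F <= size strip_grid * size strip_grid)%N.
Proof.
case: F => [//|e0 F]; set F' := e0 :: F => uF FP.
have [] := FP e0 (mem_head _ _).
case: e0 @F' uF FP => p0 q0 F' uF FP /= p0s q0s l0 k0.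
set L := euclid p0 q0.
have L0 : 0 < L by have := D64; rewrite /L; lra.
have LD : D - 1 <= L <= D.
  rewrite l0 diam //; apply/eqP => pq; move: L0.
  by rewrite /L pq /Defs.edist !subrr expr0n addr0 sqrtr0 ltxx.
pose u : R * R := ((q0 - p0).1 / L, (q0 - p0).2 / L).
pose u' : R * R := ((p0 - q0).1 / L, (p0 - q0).2 / L).
have Lsq : dot (q0 - p0) (q0 - p0) = L ^+ 2 by rewrite -euclid_sqr euclidC.
have u1 : dot u u = 1.
  transitivity (dot (q0 - p0) (q0 - p0) / L ^+ 2).
    by rewrite /u /dot /=; field; rewrite gt_eqF.
  by rewrite Lsq divff // expf_neq0 // gt_eqF.
have u'1 : dot u' u' = 1 by rewrite -u1 /dot /=; field; rewrite gt_eqF.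
have uE : q0 - p0 = (L * u.1, L * u.2).
  by rewrite /u /= !(mulrC L) !divfK ?gt_eqF.
have u'E : p0 - q0 = (L * u'.1, L * u'.2).
  by rewrite /u' /= !(mulrC L) !divfK ?gt_eqF.
have strips e : e \in F' -> in_strip p0 u e.1 /\ in_strip q0 u' e.2.
  case: e => p q /FP[/= ps qs l ke].
  have close : dot ((q - p) - (q0 - p0)) ((q - p) - (q0 - p0)) <= 17 * D.
    apply: (edge_class_close hD D64 h1); last by rewrite ke k0.
      by rewrite dot_long // dot_diam.
    by rewrite dot_long // dot_diam.
  have sq5 (x : R) : x ^+ 2 <= 25 * D -> - (5 * h) <= x <= 5 * h.
    by move=> xD; apply: sqr_le_itv => //; rewrite exprMn hD; lra.
  split.
    have [] := endpoint_strip D64 LD u1 uE (dot_long l) close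
      (dot_diam ps q0s) (dot_diam p0s qs).
    by move=> x /sq5 y.
  have l' : D - 1 <= euclid q p by rewrite euclidC.
  have close' : dot ((p - q) - (p0 - q0)) ((p - q) - (p0 - q0)) <= 17 * D.
    by rewrite -(opprB q p) -(opprB q0 p0) -opprD dotN.
  have [] := endpoint_strip D64 LD u'1 u'E (dot_long l') close'
    (dot_diam qs p0s) (dot_diam q0s ps).
  by move=> x /sq5 y.
rewrite -[(size F).+1]/(size F').
have -> : (size strip_grid * size strip_grid =
    size [seq (a, b) | a <- strip_grid, b <- strip_grid])%N.
  by rewrite size_allpairs.
pose f e := (strip_cell p0 u e.1, strip_cell q0 u' e.2).
apply: (@size_le_inj _ _ f) => //.
  by move=> e /strips[x y]; apply: allpairs_f; apply: strip_cell_grid.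
move=> e e' eF e'F [] /= cx1 cy1 cx2 cy2.
have [a b] := strips e eF; have [a' b'] := strips e' e'F.
have [e1 e2 _ _] := FP e eF; have [e1' e2' _ _] := FP e' e'F.
rewrite [e]surjective_pairing [e']surjective_pairing; congr (_, _).
  by apply: (strip_cell_inj u1 _ _ a a') => //; rewrite /strip_cell cx1 cy1.
by apply: (strip_cell_inj u'1 _ _ b b') => //; rewrite /strip_cell cx2 cy2.
Qed.

Definition classes :=
  [seq (x, i) | x <- [seq (a, b) | a <- [:: true; false], b <- [:: true; false]],
                i <- iota 0 (Num.truncn ((D - - D) / h)).+1].

Lemma edge_class_in v : dot v v <= D ^+ 2 -> edge_class D h v \in classes.
Proof.
rewrite /dot -!expr2 => vD.
have cb (x y : R) : x ^+ 2 + y ^+ 2 <= D ^+ 2 ->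
    cell (- D) h y \in iota 0 (Num.truncn ((D - - D) / h)).+1.
  move=> xy; rewrite mem_iota /= add0n; apply: cell_bound => //.
  apply: sqr_le_itv => //.
  by apply: le_trans xy; rewrite lerDr sqr_ge0.
rewrite /edge_class; case: ifP => _; apply: allpairs_f.
- by case: (0 <= v.1).
- exact: cb vD.
- by case: (0 <= v.2).
- by apply: (cb v.2); rewrite addrC.
Qed.

(** There are at most [4 * (2 * h + 1) <= 12 * h] classes, and a strip has at most
    [25 * (20 * h + 1) <= 525 * h] cells. *)
Lemma near_diameter_count :
  (count (fun d => D - 1 <= d) (pair_dists s))%:R <= 12 * 525 ^+ 2 * h ^+ 3.
Proof.
rewrite pair_distsE count_map -size_filter; set E := seq.filter _ _.
have uE : uniq E by rewrite filter_uniq // uniq_pairs.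
have EP e : e \in E -> [/\ e.1 \in s, e.2 \in s & D - 1 <= euclid e.1 e.2].
  by rewrite mem_filter /= => /andP[l /mem_pairs[]].
have szE : (size E <= size classes * (size strip_grid * size strip_grid))%N.
  apply: (@size_le_fibers _ _ (fun e => edge_class D h (e.2 - e.1))).
    by move=> e /EP[e1 e2 _]; apply: edge_class_in; exact: dot_diam.
  move=> k; rewrite -size_filter; apply: (@edges_of_class _ k).
    exact: filter_uniq.
  by move=> e; rewrite mem_filter => /andP[/eqP ke /EP[]].
apply: (@le_trans _ _ (size classes * (size strip_grid * size strip_grid))%:R).
  by rewrite ler_nat.
have trunc (x : R) : 0 <= x -> (Num.truncn x).+1%:R <= x + 1.
  by move=> x0; rewrite -natr1 lerD2r truncn_le.
have c1 : (size classes)%:R <= 12 * h :> R.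
  rewrite /classes !size_allpairs size_iota natrM.
  apply: (@le_trans _ _ (4 * ((D - - D) / h + 1))).
    by rewrite ler_wpM2l // trunc // opprK divr_ge0 ?addr_ge0 ?(ltW h0).
  have -> : (D - - D) / h = 2 * h by rewrite -hD; field; rewrite gt_eqF.
  by have := h1; lra.
have c2 : (size strip_grid)%:R <= 525 * h :> R.
  rewrite /strip_grid !size_allpairs !size_iota natrM.
  apply: (@le_trans _ _ ((12 / (1 / 2) + 1) * (10 * h / (1 / 2) + 1))).
    by apply: ler_pM => //; apply: trunc; have := h1; lra.
  by have := h1; lra.
rewrite !natrM; apply: (@le_trans _ _ ((12 * h) * ((525 * h) * (525 * h)))).
  by apply: ler_pM => //; apply: ler_pM.
rewrite le_eqVlt; apply/orP; left; apply/eqP; ring.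
Qed.
End NearDiameter.

End Geometry.

(** * Gaps between consecutive distances *)

Lemma sqr_gap_le (R : realFieldType) (d : nat -> R) (j N : nat) :
  (1 <= j <= N)%N ->
  (d N - d j) ^+ 2 <= (N - j)%:R * \sum_(1 <= i < N) (d i.+1 - d i) ^+ 2.
Proof.
move=> /andP[j1 jN]; rewrite -telescope_sumr //.
apply: le_trans (sqr_sum_le _ _ _) _; rewrite ler_wpM2l //.
by rewrite (big_cat_nat j1 jN) /= lerDr sumr_ge0 // => i _; exact: sqr_ge0.
Qed.

(** In a sorted list, every entry from the first one [>= t] onwards is [>= t]. *)
Lemma count_sorted_ge (R : realType) (ds : seq R) (t : R) :
  sorted <=%R ds ->
  (size ds - find (fun x => (t <= x)%R) ds <= count (fun x => (t <= x)%R) ds)%N.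
Proof.
move=> sd; set a := fun x => t <= x; set j := find a ds.
rewrite -size_drop -{2}(cat_take_drop j ds) count_cat.
suff /eqP -> : count a (drop j ds) == size (drop j ds) by rewrite leq_addl.
rewrite -all_count; apply/(all_nthP 0) => i; rewrite size_drop ltn_subRL => ij.
have hasa : has a ds by rewrite has_find (leq_ltn_trans _ ij) // leq_addr.
rewrite nth_drop; apply: le_trans (nth_find 0 hasa) _.
have := sorted_leq_nth le_trans le_refl 0 sd.
move=> /(_ (find a ds) (j + i)%N); rewrite !inE => -> //; last exact: leq_addr.
by rewrite -has_find.
Qed.

Section Distances.
Variables (R : realType) (P : {fset R * R}).
Let s := enum_fset P.
Let ds := sorted_dists P.
Let N := 'C(#|` P|, 2).

Lemma euclid_in_sorted_dists p q : p \in s -> q \in s -> p != q -> euclid p q \in ds.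
Proof. by move=> ps qs pq; rewrite mem_sort euclid_in_pair_dists. Qed.

Lemma sorted_dists_sorted : sorted <=%R ds.
Proof. exact: sort_sorted le_total _. Qed.

Lemma nth_dist_bounds x : x \in ds -> nth_dist P 1 <= x <= nth_dist P N.
Proof.
move=> xds; have szds : size ds = N := size_sorted_dists P.
have ix : (index x ds < N)%N by rewrite -szds index_mem.
have N0 : (0 < N)%N by apply: leq_trans ix.
have mono := sorted_leq_nth le_trans le_refl 0 sorted_dists_sorted.
rewrite /nth_dist /= -/ds -{1 2}(nth_index 0 xds); apply/andP.
by split; apply: mono; rewrite ?inE ?szds ?ltn_predL ?index_mem // -ltnS prednK.
Qed.

(** Otherwise [packing] with [k = 256 = 4 * 64] bounds the number of points. *)
Lemma long_diameter :
  (257 * 257 < #|` P|)%N -> 0 < nth_dist P 1 -> 64 * nth_dist P 1 <= nth_dist P N.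
Proof.
move=> big d0; rewrite leNgt; apply/negP => short.
have : (size s <= 256.+1 * 256.+1)%N.
  apply: (@packing _ _ (nth_dist P 1) (nth_dist P N)) => //; first exact: fset_uniq.
  - by lra.
  - by move=> p q ps qs /(euclid_in_sorted_dists ps qs)/nth_dist_bounds/andP[].
  - by move=> p q ps qs /(euclid_in_sorted_dists ps qs)/nth_dist_bounds/andP[].
by rewrite leqNgt big.
Qed.

(** The gaps between the last distance below [D - 1] and [D] add up to at least 1
    and are at most as many as the pairs counted by [near_diameter_count]. *)
Lemma gaps_short_diameter (y : R)
    (S := \sum_(1 <= i < N) (nth_dist P i.+1 - nth_dist P i) ^+ 2) :
  1 <= nth_dist P 1 -> 64 * nth_dist P 1 <= nth_dist P N ->
  0 < y -> nth_dist P N <= y ^+ 2 ->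
  1 <= 12 * 525 ^+ 2 * y ^+ 3 * S.
Proof.
move=> d1 d64 y0; set D := nth_dist P N => Dy.
have szds : size ds = N := size_sorted_dists P.
have S0 : 0 <= S by apply: sumr_ge0 => i _; exact: sqr_ge0.
have D64 : 64 <= D by rewrite -/D in d64; lra.
have D0 : 0 <= D by lra.
pose h := Num.sqrt D.
have hD : h ^+ 2 = D by rewrite sqr_sqrtr.
have h0 : 0 <= h := sqrtr_ge0 D.
have h1 : 1 <= h by rewrite leNgt; apply/negP => h1; nra.
have hy : h <= y by rewrite -(@ler_pXn2r _ 2) ?nnegrE ?(ltW y0) // hD.
pose a x := D - 1 <= x.
have few : (count a ds)%:R <= 12 * 525 ^+ 2 * y ^+ 3.
  rewrite (permP (permEl (perm_sort _ _))).
  apply: (@le_trans _ _ (12 * 525 ^+ 2 * h ^+ 3)).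
    apply: (@near_diameter_count _ s D h) => //; first exact: fset_uniq.
    - move=> p q ps qs /(euclid_in_sorted_dists ps qs)/nth_dist_bounds/andP[].
      by move=> l _; exact: le_trans l.
    - by move=> p q ps qs /(euclid_in_sorted_dists ps qs)/nth_dist_bounds/andP[].
  apply: ler_wpM2l; last by rewrite lerXn2r ?nnegrE ?(ltW y0).
  exact: mulr_ge0 (ler0n _ 12) (exprn_ge0 2 (ler0n _ 525)).
have N0 : (0 < N)%N.
  rewrite lt0n; apply/eqP => N0; move: D64.
  by rewrite /D N0 /nth_dist /= -/ds nth_default ?szds ?N0 // lern0.
(* There are j distances below D - 1, and nth_dist counts from 1, so that
   nth_dist P j is the largest of them. *)
pose j := find a ds.
have Dds : D \in ds by rewrite /D /nth_dist mem_nth // szds ltn_predL.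
have hasa : has a ds by apply/hasP; exists D => //; rewrite /a; lra.
have jN : (j < N)%N by rewrite -szds -has_find.
have j0 : (0 < j)%N.
  rewrite lt0n; apply/eqP => j0.
  have := nth_find 0 hasa; rewrite -/j j0 /a -/ds.
  rewrite -[ds`_0]/(nth_dist P 1); rewrite -/D in d64; lra.
have dj : nth_dist P j < D - 1.
  rewrite ltNge; apply/negbT; apply: (@before_find _ 0 a ds).
  by rewrite -/j ltn_predL.
have := @sqr_gap_le _ (nth_dist P) j N; rewrite j0 (ltnW jN) -/S -/D => /(_ isT) gap.
have le1 : 1 <= (D - nth_dist P j) ^+ 2 by nra.
apply: (le_trans le1); apply: (le_trans gap); apply: ler_wpM2r => //.
apply: le_trans few; rewrite ler_nat -szds.
exact: count_sorted_ge sorted_dists_sorted.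
Qed.

(** [sqr_gap_le] with [j = 1]: the gaps add up to at least [D / 2 >= y ^+ 2 / 2]
    and there are at most [y ^+ 7] of them. *)
Lemma gaps_long_diameter (y : R)
    (S := \sum_(1 <= i < N) (nth_dist P i.+1 - nth_dist P i) ^+ 2) :
  1 <= nth_dist P 1 -> 64 * nth_dist P 1 <= nth_dist P N ->
  0 < y -> y ^+ 7 = (#|` P|)%:R ^+ 2 -> y ^+ 2 <= nth_dist P N ->
  1 <= 4 * y ^+ 3 * S.
Proof.
move=> d1; set D := nth_dist P N => d64 y0 yn yD.
have S0 : 0 <= S by apply: sumr_ge0 => i _; exact: sqr_ge0.
have szds : size ds = N := size_sorted_dists P.
have N0 : (0 < N)%N.
  rewrite lt0n; apply/eqP => N0; move: d1.
  by rewrite /nth_dist /= -/ds nth_default ?szds ?N0 // ler10.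
have := @sqr_gap_le _ (nth_dist P) 1 N; rewrite N0 -/S -/D => /(_ isT) gap.
have Ny : (N - 1)%:R <= y ^+ 7.
  rewrite yn -natrX ler_nat (leq_trans (leq_subr _ _)) // /N bin2.
  by rewrite -divn2 (leq_trans (leq_div _ _)) // -mulnn leq_mul // leq_pred.
have l : (y ^+ 2 / 2) ^+ 2 <= y ^+ 7 * S.
  apply: (@le_trans _ _ ((D - nth_dist P 1) ^+ 2)).
    have y20 := sqr_ge0 y.
    by rewrite lerXn2r ?nnegrE; lra.
  by apply: le_trans gap _; apply: ler_wpM2r.
have y4 : 0 < y ^+ 4 by rewrite exprn_gt0.
rewrite -(ler_pM2l y4); move: l.
have -> : (y ^+ 2 / 2) ^+ 2 = y ^+ 4 / 4 by field.
have -> : y ^+ 4 * (4 * y ^+ 3 * S) = 4 * (y ^+ 7 * S) by ring.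
lra.
Qed.
End Distances.

(** * The lower bound *)

Theorem mainTheorem2 (R : realType) :
  exists2 c' : R, 0 < c' &
  exists n0 : nat, forall n : nat, (n0 <= n)%N ->
  forall P : {fset R * R}, #|` P|%fset = n -> 1 <= nth_dist P 1 ->
    c' * (n%:R `^ (- (6%:R / 7%:R))) <=
      \sum_(1 <= i < 'C(n, 2)) (nth_dist P i.+1 - nth_dist P i) ^+ 2.
Proof.
(* The value of the constant is hidden, lest it be computed in unary. *)
pose C : R := 12 * 525 ^+ 2.
have CE : 12 * 525 ^+ 2 = C by [].
have C4 : 4 <= C by rewrite -CE; lra.
clearbody C.
have C0 : 0 < C by lra.
exists C^-1; first by rewrite invr_gt0.
exists (257 * 257).+1 => n n0 P Pn d1.
rewrite -Pn in n0 *; move: Pn => _; set S := \sum_(_ <= _ < _) _.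
have n_gt0 : 0 < #|` P|%:R :> R by rewrite ltr0n (leq_trans _ n0).
have d0 : 0 < nth_dist P 1 by lra.
have d64 := long_diameter n0 d0.
pose y : R := #|` P|%:R `^ (2 / 7).
have y0 : 0 < y by rewrite powR_gt0.
have y7 : y ^+ 7 = #|` P|%:R ^+ 2.
  rewrite -powR_mulrn ?(ltW y0) // -powRrM -powR_mulrn ?ltW //.
  by congr (_ `^ _); field.
have -> : #|` P|%:R `^ (- (6%:R / 7%:R)) = (y ^+ 3)^-1.
  rewrite powRN -(powR_mulrn 3 (ltW y0)) -powRrM; congr (_ `^ _)^-1.
  by field.
have y3 : 0 < y ^+ 3 by rewrite exprn_gt0.
rewrite -invfM -div1r ler_pdivrMr ?mulr_gt0 // mulrC.
have [yD|/ltW Dy] := leP (y ^+ 2) (nth_dist P 'C(#|` P|, 2)); last first.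
  by rewrite -CE; exact: gaps_short_diameter.
apply: le_trans (gaps_long_diameter d1 d64 y0 y7 yD) _.
rewrite -/S ler_wpM2r ?sumr_ge0 // => [i _|]; first exact: sqr_ge0.
by rewrite ler_pM2r.
Qed.
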